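(* Let $G$ be a completely metrizable topological group, let $d$ be a left-invariant compatible metric on $G$, and let $T\colon G\to G$ be a continuous endomorphism of $G$. Then $T$ is either equicontinuous or sensitive (with respect to $d$).
   Context: A topological group is completely metrizable if its topology is induced by some complete metric. A compatible metric $d$ on $G$ is a metric inducing the topology of $G$ (it is not required to be complete); it is left-invariant if $d(zx,zy)=d(x,y)$ for all $x,y,z\in G$. A continuous endomorphism is a continuous group homomorphism $T\colon G\to G$. $\mathbb{N}$ is the set of positive integers. $T$ is equicontinuous if for any $\varepsilon>0$ there exists $\delta>0$ such that $d(T^nx,T^ny)<\varepsilon$ for all $x,y\in G$ with $d(x,y)<\delta$ and all $n\in\mathbb{N}$. $T$ is sensitive if there exists $\delta>0$ such that for every $x\in G$ and $\varepsilon>0$ there exist $y\in G$ with $d(x,y)<\varepsilon$ and $n\in\mathbb{N}$ such that $d(T^nx,T^ny)>\delta$. *)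

(* Defs.v *)
From HB Require Import structures.
From mathcomp Require Import all_boot all_order all_algebra.
From mathcomp Require Import boolp classical_sets reals topology.

Set Implicit Arguments.
Unset Strict Implicit.
Unset Printing Implicit Defensive.

Import Order.TTheory GRing.Theory Num.Theory.

Local Open Scope classical_set_scope.
Local Open Scope ring_scope.

HB.structure Definition PreTopologicalGroup := {G of Topological G & Group G}.

HB.mixin Record PreTopologicalGroup_isTopologicalGroup G
    & PreTopologicalGroup G := {
  mulg_continuous : continuous (fun p : G * G => (p.1 * p.2)%g) ;
  invg_continuous : continuous (fun x : G => (x^-1)%g)
}.

#[short(type="topologicalGroupType")]
HB.structure Definition TopologicalGroup :=
  {G of PreTopologicalGroup G & PreTopologicalGroup_isTopologicalGroup G}.

(* Metrics are explicit functions and not instances of [metricType]: the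
   theorem involves two metrics on one group, the given one and the complete
   one.  Nonnegativity follows from these axioms, as in the factory [isMetric]. *)
Definition is_metric (R : realType) (X : Type) (d : X -> X -> R) : Prop :=
  [/\ forall x y, d x y = 0 <-> x = y,
      forall x y, d x y = d y x
    & forall y x z, d x z <= d x y + d y z].

Definition compatible_metric (R : realType) (X : topologicalType)
    (d : X -> X -> R) : Prop :=
  is_metric d /\
  forall x : X, nbhs x = nbhs_ball_ (fun y e => [set z | d y z < e]) x.

(* To be used for a compatible [d]: the limit is taken in the given topology. *)
Definition complete_metric (R : realType) (X : topologicalType)
    (d : X -> X -> R) : Prop :=
  forall u : nat -> X,
    (forall e : R, 0 < e -> exists N : nat, forall m n : nat,
        (N <= m)%N -> (N <= n)%N -> d (u m) (u n) < e) ->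
    exists l : X, u @ \oo --> l.

Definition completely_metrizable (R : realType) (X : topologicalType) : Prop :=
  exists d : X -> X -> R, compatible_metric d /\ complete_metric d.

Definition left_invariant (R : realType) (G : groupType)
    (d : G -> G -> R) : Prop :=
  forall x y z : G, d (z * x)%g (z * y)%g = d x y.

Definition equicontinuous_map (R : realType) (X : Type) (d : X -> X -> R)
    (T : X -> X) : Prop :=
  forall e : R, 0 < e -> exists2 delta : R, 0 < delta &
    forall x y : X, d x y < delta ->
    forall n : nat, (0 < n)%N -> d (iter n T x) (iter n T y) < e.

Definition sensitive_map (R : realType) (X : Type) (d : X -> X -> R)
    (T : X -> X) : Prop :=
  exists2 delta : R, 0 < delta &
    forall (x : X) (e : R), 0 < e ->
    exists (y : X) (n : nat),
      [/\ d x y < e, (0 < n)%N & delta < d (iter n T x) (iter n T y)].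

Lemma compatible_mdist (R : realType) (X : metricType R) :
  compatible_metric (@mdist R X).
Proof.
split.
  split; [|exact: metric_sym|by move=> y x z; exact: metric_triangle].
  by move=> x y; split=> [/mdist_positivity//|->]; exact: mdistxx.
move=> x; rewrite -nbhs_ballE /nbhs_ball; congr (nbhs_ball_ _ x).
by apply/funext => y; apply/funext => e; exact: ballEmdist.
Qed.

(* Main.v *)
Require Import Defs.
From mathcomp Require Import all_boot all_order all_algebra.
From mathcomp Require Import boolp classical_sets reals topology.

(** A left translation by [z] does not change distances, and [T ^ n] carries it
    to the left translation by [T ^ n z], which does not change distances
    either.  So a pair [(x, y)] may be moved to any base point [x0], by
    [z = x0 * x^-1], without changing the distance of the pair or the distances
    of its iterates ([dist_iter_translate]).  A failure of equicontinuity gives,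
    for some [e > 0], arbitrarily close pairs that some iterate of [T] separates
    by at least [e]; translating them to each point of [G] gives sensitivity,
    with any constant below [e], for instance [e / 2]. *)

Import Order.TTheory GRing.Theory Num.Theory.
Local Open Scope ring_scope.

Lemma iter_gmulfM (G : groupType) (T : {multiplicative G -> G}) (n : nat) :
  {morph iter n T : x y / (x * y)%g}.
Proof. by elim: n => [//|n IHn] x y; rewrite !iterS IHn gmulfM. Qed.

Lemma dist_iter_translate (R : realType) (G : groupType) (d : G -> G -> R)
    (T : {multiplicative G -> G}) (n : nat) (x y z : G) :
  left_invariant d ->
  d (iter n T (z * x)%g) (iter n T (z * y)%g) = d (iter n T x) (iter n T y).
Proof. by move=> d_inv; rewrite !iter_gmulfM d_inv. Qed.

Lemma not_equicontinuous_sensitive (R : realType) (G : groupType)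
    (d : G -> G -> R) (T : {multiplicative G -> G}) :
  left_invariant d -> ~ equicontinuous_map d T -> sensitive_map d T.
Proof.
move=> d_inv /existsNP[e /not_implyP[e_gt0 separated]].
exists (e / 2); first exact: divr_gt0.
move=> x0 r r_gt0; apply: contrapT => close_orbits; apply: separated.
exists r => // x y dxy n n_gt0.
rewrite ltNge; apply/negP => e_le; apply: close_orbits.
pose z := (x0 * x^-1)%g.
have zx : (z * x = x0)%g by rewrite /z mulgVK.
exists (z * y)%g, n; rewrite -zx d_inv dist_iter_translate //.
split=> //; apply: lt_le_trans e_le.
by rewrite ltr_pdivrMr // ltr_pMr // ltr1n.
Qed.

Theorem theorem3p11 (R : realType) (G : topologicalGroupType)
    (G_completely_metrizable : completely_metrizable R G)
    (d : G -> G -> R)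
    (d_compatible : compatible_metric d)
    (d_left_invariant : left_invariant d)
    (T : {multiplicative G -> G})
    (T_continuous : continuous T) :
  equicontinuous_map d T \/ sensitive_map d T.
Proof.
case: (pselect (equicontinuous_map d T)) => [|not_eq]; first by left.
by right; exact: not_equicontinuous_sensitive.
Qed.
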